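(* Let $N\ge 6$ and $q>0$, let $\mathcal X=\mathbb Z/N\mathbb Z$, and let $Q:\mathcal X\times\mathcal X\to\mathbb R$ be the discrete Laplacian given by $Q(x,y)=q$ if $x-y\equiv\pm1 \pmod N$, $Q(x,x)=-2q$, and $Q(x,y)=0$ otherwise. Let $\pi(x)=\frac1N$ for all $x$. Let $m=2$, i.e. $\phi_2(r)=r^2$, $f_2(r)=r^2$ and $\theta_2(r,s)=\frac{r+s}{2}$; let $\mathcal W$ be the non-local transportation metric associated with $\theta_2$, and let $\mathcal F_2(\rho)=\sum_{x\in\mathcal X}\rho(x)^2\pi(x)$ be the R\'enyi entropy. Then $\mathcal F_2$ is not convex along $\mathcal W$-geodesics. More precisely, $$\kappa_Q\le-\frac{qN}{2},$$ where $\kappa_Q$ is the supremum of all $\kappa\in\mathbb R$ such that $\mathcal F_2$ is $\kappa$-convex along $\mathcal W$-geodesics (with $\sup\emptyset=-\infty$).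
   Context: $\mathscr P(\mathcal X)=\{\rho:\mathcal X\to[0,\infty):\sum_x\rho(x)\pi(x)=1\}$. For $\rho\in\mathscr P(\mathcal X)$ write $\hat\rho(x,y)=\theta_2(\rho(x),\rho(y))$. **Metric.** For $\bar\rho_0,\bar\rho_1\in\mathscr P(\mathcal X)$, $\mathcal W(\bar\rho_0,\bar\rho_1)^2$ is the infimum of $\int_0^1\frac12\sum_{x,y}(\psi_t(y)-\psi_t(x))^2\hat\rho_t(x,y)Q(x,y)\pi(x)\,dt$ over all pairs $(\rho,\psi)$ with $\rho:[0,1]\to\mathbb R^{\mathcal X}$ of class $C^\infty$, $\rho_t\in\mathscr P(\mathcal X)$ for all $t\in[0,1]$, $\rho_0=\bar\rho_0$, $\rho_1=\bar\rho_1$, $\psi:[0,1]\to\mathbb R^{\mathcal X}$ measurable, and $\partial_t\rho_t(x)+\sum_y(\psi_t(y)-\psi_t(x))\hat\rho_t(x,y)Q(x,y)=0$ for all $x\in\mathcal X$, $t\in(0,1)$. **Geodesic convexity.** A constant speed geodesic is a curve $(\rho_t)_{t\in[0,1]}$ in $\mathscr P(\mathcal X)$ with $\mathcal W(\rho_s,\rho_t)=|s-t|\,\mathcal W(\rho_0,\rho_1)$ for all $s,t\in[0,1]$. A functional $\mathcal F$ is $\kappa$-convex along $\mathcal W$-geodesics if for every constant speed geodesic and all $t\in[0,1]$, $\mathcal F(\rho_t)\le(1-t)\mathcal F(\rho_0)+t\mathcal F(\rho_1)-\frac\kappa2t(1-t)\mathcal W(\rho_0,\rho_1)^2$; convex means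 $0$-convex. *)

(* Defs.v *)
From HB Require Import structures.
From mathcomp Require Import all_boot all_order all_algebra.
From mathcomp Require Import all_classical all_reals all_analysis.

Set Implicit Arguments.
Unset Strict Implicit.
Unset Printing Implicit Defensive.

Import Order.TTheory GRing.Theory Num.Theory.
Import numFieldNormedType.Exports.

Local Open Scope classical_set_scope.
Local Open Scope ring_scope.

(* f is C^oo on [0, 1]: all derivatives exist on ]0, 1[ and extend
   continuously to [0, 1].  g n is the (extended) n-th derivative; the values
   of f outside [0, 1] are irrelevant. *)
Definition smooth01 (R : realType) (f : R -> R) : Prop :=
  exists2 g : nat -> R -> R, g 0%N = f &
    forall n, derivable_oo_LRcontinuous (g n) 0 1 /\
              {in `]0, 1[, derive1 (g n) =1 g n.+1}.

Section metric.
Context (R : realType) (X : finType).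
Variables (theta : R -> R -> R) (Q : X -> X -> R) (pi : X -> R).

Definition is_density (rho : X -> R) : Prop :=
  (forall x, 0 <= rho x) /\ \sum_x rho x * pi x = 1.

Definition action (rho psi : X -> R) : R :=
  2^-1 * \sum_x \sum_y
    (psi y - psi x) ^+ 2 * theta (rho x) (rho y) * Q x y * pi x.

Definition continuity_equation (rho psi : R -> X -> R) : Prop :=
  forall (x : X) (t : R), 0 < t < 1 ->
    derive1 (fun s => rho s x) t
    + \sum_y (psi t y - psi t x) * theta (rho t x) (rho t y) * Q x y = 0.

(* Curves indexed by [0, 1] are functions on R that are constrained only on
   [0, 1]. *)
Definition admissible (rho0 rho1 : X -> R) (rho psi : R -> X -> R) : Prop :=
  [/\ forall x, smooth01 (fun t => rho t x),
      forall t : R, 0 <= t <= 1 -> is_density (rho t),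
      rho 0 = rho0 /\ rho 1 = rho1,
      forall x, measurable_fun (`[0, 1] : set R) (fun t => psi t x) &
      continuity_equation rho psi].

Definition W (rho0 rho1 : X -> R) : \bar R :=
  sqrte (ereal_inf [set e : \bar R | exists rho psi : R -> X -> R,
    admissible rho0 rho1 rho psi /\
    e = (\int[lebesgue_measure]_(t in `[0%R, 1%R])
           (action (rho t) (psi t))%:E)%E]).

Definition const_speed_geodesic (rho : R -> X -> R) : Prop :=
  (forall t : R, 0 <= t <= 1 -> is_density (rho t)) /\
  (forall s t : R, 0 <= s <= 1 -> 0 <= t <= 1 ->
     W (rho s) (rho t) = (`|s - t|%:E * W (rho 0%R) (rho 1%R))%E).

Definition geod_convex (F : (X -> R) -> R) (kappa : R) : Prop :=
  forall rho : R -> X -> R, const_speed_geodesic rho ->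
  forall t : R, 0 <= t <= 1 ->
    ((F (rho t))%:E <=
       ((1 - t) * F (rho 0) + t * F (rho 1))%:E
       - (kappa / 2 * t * (1 - t))%:E * W (rho 0%R) (rho 1%R) ^+ 2)%E.

Definition kappaQ (F : (X -> R) -> R) : \bar R :=
  ereal_sup [set k%:E | k in geod_convex F].

End metric.

Definition theta2 (R : realType) (r s : R) : R := (r + s) / 2.

Definition renyi2 (R : realType) (X : finType) (pi : X -> R) (rho : X -> R)
  : R := \sum_x rho x ^+ 2 * pi x.

(* 'Z_N is Z/NZ only when 1 < N. *)
Definition discrete_laplacian (R : realType) (N : nat) (q : R) (x y : 'Z_N)
  : R :=
  if (x - y == 1) || (x - y == -1) then q
  else if x == y then - (2 * q) else 0.

Definition uniform_pi (R : realType) (N : nat) (x : 'Z_N) : R := N%:R^-1.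
Arguments uniform_pi R N x : clear implicits.

(* Main.v *)
Require Import Defs.
From mathcomp Require Import all_boot all_order all_algebra.
From mathcomp Require Import all_classical all_reals all_analysis.
From mathcomp Require Import measurable_realfun ring lra.

(** The mean [theta2] is affine in the densities, so the action is linear in
    the density: [action rho psi] is twice the mean of the function [hj psi]
    under [rho pi].  The geodesic equations of the metric therefore decouple:
    the potential solves the Hamilton-Jacobi system [psi' = - hj psi], in which
    no density occurs, and the density is then transported by [psi].

    A solution [psi] of the Hamilton-Jacobi system is a dual certificate.  For
    every admissible pair [(mu, phi)], Young's inequality bounds the derivative
    of [2 <psi, mu>] by the action of [(mu, phi)], with equality when
    [phi = psi] ([hj_dual_le], [hj_dual_eq]).  Integrating in time, every
    solution of the two equations whose density stays nonnegative minimizes the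
    action among all competitors ([W_flow01]); since the action is conserved
    along it, it is a constant speed geodesic of known length ([W_flow],
    [flow_const_speed_geodesic]).

    The two equations form a system with quadratic right-hand side, so its
    formal power series solution has geometrically bounded coefficients and
    converges ([geodesic_flow_exists]).  Hence every positive density is the
    origin of a smooth geodesic in every direction, and testing convexity at the
    midpoint of shorter and shorter pieces of it gives the infinitesimal
    inequality [kappa * action <= renyi2_hessian] ([geod_convex_hessian_ge]).

    On the cycle this inequality is evaluated near the density concentrated in
    one point, for a potential with slope one across the two edges at this
    point and slope zero across the next two edges.  There the action is [q]
    and the second variation is [- q ^ 2 N / 2].  The point mass itself is not
    allowed, since the flow would make the density negative at a neighbour, so
    it is approached by positive densities. *)

Set Implicit Arguments.
Unset Strict Implicit.
Unset Printing Implicit Defensive.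

Import Order.TTheory GRing.Theory Num.Theory.
Import numFieldNormedType.Exports.

Local Open Scope classical_set_scope.
Local Open Scope ring_scope.

(** * Calculus on the real line *)

Section calculus.
Context (R : realType).

Lemma is_derive_bigsum (I : Type) (s : seq I) (f : I -> R -> R)
    (df : I -> R) (t : R) :
  (forall i, is_derive t 1 (f i) (df i)) ->
  is_derive t 1 (fun u => \sum_(i <- s) f i u) (\sum_(i <- s) df i).
Proof.
move=> fE; elim: s => [|i s IH].
  rewrite big_nil; under eq_fun do rewrite big_nil; exact: is_derive_cst.
rewrite big_cons; under eq_fun do rewrite big_cons; exact: is_deriveD.
Qed.

Lemma is_derive_continuous (f : R -> R) (t df : R) :
  is_derive t 1 f df -> {for t, continuous f}.
Proof. by move=> fE; apply/differentiable_continuous/derivable1_diffP. Qed.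

Lemma is_derive_within (f df : R -> R) (A : set R) :
  (forall t, A t -> is_derive t 1 f (df t)) -> {within A, continuous f}.
Proof.
move=> fE; apply: continuous_in_subspaceT => t /set_mem At.
exact: is_derive_continuous (fE t At).
Qed.

Lemma derive_eq0_cst (f : R -> R) (a b : R) : a <= b ->
  (forall t, a <= t <= b -> is_derive t 1 f 0) -> f b = f a.
Proof.
move=> ab fE; apply/eqP; rewrite -subr_eq0.
have cf : {within `[a, b], continuous f}.
  by apply: (@is_derive_within _ (fun=> 0)) => t /=; rewrite in_itv/=; exact: fE.
have [|c _ ->] := @MVT_segment R f (fun=> 0) a b ab _ cf; last by rewrite mul0r.
by move=> t; rewrite in_itv/= => /andP[/ltW at_ /ltW tb]; apply: fE; rewrite at_.
Qed.

(** Unlike [smooth01], two-sided derivatives are required at every point of [A];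
    the class is then stable under affine changes of time. *)
Definition smooth_on (A : set R) (f : R -> R) : Prop :=
  exists2 g : nat -> R -> R, g 0%N = f &
    forall n t, A t -> is_derive t 1 (g n) (g n.+1 t).

Lemma is_derive_oo_LRcontinuous (f df : R -> R) (a b : R) : a < b ->
  (forall t, a <= t <= b -> is_derive t 1 f (df t)) ->
  derivable_oo_LRcontinuous f a b.
Proof.
move=> ab fE; split.
- move=> t; rewrite in_itv/= => /andP[a0 t1].
  by have := fE t; rewrite (ltW a0) (ltW t1) => /(_ isT)[].
- apply: cvg_at_right_filter; apply: (@is_derive_continuous _ _ (df a)).
  by apply: fE; rewrite lexx ltW.
- apply: cvg_at_left_filter; apply: (@is_derive_continuous _ _ (df b)).
  by apply: fE; rewrite lexx ltW.
Qed.

Lemma smooth_on_smooth01 (f : R -> R) :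
  smooth_on [set t | 0 <= t <= 1] f -> smooth01 f.
Proof.
move=> [g g0 gE]; exists g => // n; split.
  exact: is_derive_oo_LRcontinuous ltr01 (gE n).
move=> t; rewrite in_itv/= => /andP[t0 t1]; rewrite derive1E.
by have := gE n t; rewrite /= (ltW t0) (ltW t1) => /(_ isT)[_ ->].
Qed.

End calculus.

Lemma cvg_bigsum (R : realType) (T : Type) (F : set_system T) (FF : Filter F)
    (I : Type) (s : seq I) (f : I -> T -> R) (l : I -> R) :
  (forall i, f i @ F --> l i) ->
  (fun t => \sum_(i <- s) f i t) @ F --> \sum_(i <- s) l i.
Proof.
move=> fl; elim: s => [|i s IH].
  by rewrite big_nil; under eq_fun do rewrite big_nil; exact: cvg_cst.
rewrite big_cons; under eq_fun do rewrite big_cons; exact: cvgD.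
Qed.

Lemma is_derive_affine (R : realType) (f : R -> R) (a d u df : R) :
  is_derive (a + d * u) 1 f df ->
  is_derive u 1 (fun v => f (a + d * v)) (d * df).
Proof.
move=> fE; rewrite mulrC.
have gE : is_derive u 1 (fun v : R => a + d * v) d.
  by apply: is_derive_eq; rewrite /GRing.scale/=; ring.
exact: (@is_derive1_comp _ f (fun v : R => a + d * v)).
Qed.

Lemma smooth_on_affine (R : realType) (A : set R) (f : R -> R) (a d : R) :
  smooth_on A f ->
  smooth_on [set u | A (a + d * u)] (fun u => f (a + d * u)).
Proof.
move=> [g <- gE]; exists (fun n u => d ^+ n * g n (a + d * u)).
  by apply/funext => u; rewrite expr0 mul1r.
move=> n u Au; rewrite exprSr -mulrA.
by apply: is_deriveZ; apply: is_derive_affine; exact: gE.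
Qed.

Lemma smooth_onS (R : realType) (A B : set R) (f : R -> R) :
  B `<=` A -> smooth_on A f -> smooth_on B f.
Proof. by move=> BA [g g0 gE]; exists g => // n t /BA; exact: gE. Qed.

(** The midpoint defect [g t = f t + f 0 - 2 f (t / 2) - k t ^ 2 / 4] vanishes
    at [0], and two applications of the mean value theorem write its slope as
    [(u / 2) (f2 v - k)].  If [f2 0 < k], it is therefore negative for small
    positive [t], against the hypothesis. *)
Lemma midpoint_convex_second_derivative (R : realType) (f f1 f2 : R -> R) (k r : R) :
  0 < r ->
  (forall t : R, `|t| < r -> is_derive t 1 f (f1 t)) ->
  (forall t : R, `|t| < r -> is_derive t 1 f1 (f2 t)) ->
  {for 0, continuous f2} ->
  (forall t, 0 < t < r -> f (t / 2) <= (f 0 + f t) / 2 - k * t ^+ 2 / 8) ->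
  k <= f2 0.
Proof.
move=> r0 fE f1E cf2 fmid; rewrite leNgt; apply/negP => f2k.
have /nbhs_ballP[e /= e0 he] : \forall t \near 0, f2 t < k.
  by apply: cvgr_lt cf2 _ f2k.
have {}he t : `|t| < e -> f2 t < k.
  by move=> te; apply: he; rewrite /ball/= sub0r normrN.
pose t := Num.min r e / 2.
have m0 : 0 < Num.min r e by rewrite lt_min r0.
have t0 : 0 < t by rewrite divr_gt0.
have tm : t < Num.min r e by rewrite /t ltr_pdivrMr// mulr_natr mulr2n ltrDl.
have tr : t < r by apply: lt_le_trans tm _; rewrite ge_min lexx.
have te : t < e by apply: lt_le_trans tm _; rewrite ge_min lexx orbT.
pose g u := f u + f 0 - 2 * f (u / 2) - k * u ^+ 2 / 4.
have gE (u : R) : 0 <= u <= t -> is_derive u 1 g (f1 u - f1 (u / 2) - k * u / 2).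
  move=> /andP[u0 ut].
  have ur : `|u| < r by rewrite ger0_norm// (le_lt_trans ut).
  have hr : `|0 + 2^-1 * u| < r.
    rewrite add0r ger0_norm ?mulr_ge0// mulrC; apply: le_lt_trans ur.
    by rewrite ger0_norm//; lra.
  have h1 := fE _ ur; have h2 := is_derive_affine (fE _ hr).
  have -> : g = fun v => f v + f 0 - 2 * f (0 + 2^-1 * v) - (k / 4) * v ^+ 2.
    by apply/funext => v; rewrite /g add0r [2^-1 * v]mulrC; field.
  by apply: is_derive_eq; rewrite /GRing.scale/= add0r [2^-1 * u]mulrC; field.
have cg : {within `[0, t], continuous g}.
  by apply: (@is_derive_within _ _ (fun u => f1 u - f1 (u / 2) - k * u / 2)) => u;
    rewrite /= in_itv; exact: gE.
have gE' (u : R) : u \in `]0, t[%R -> is_derive u 1 g (f1 u - f1 (u / 2) - k * u / 2).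
  by rewrite in_itv/= => /andP[u0 ut]; apply: gE; rewrite !ltW.
have [u + gt] := MVT t0 gE' cg; rewrite in_itv/= => /andP[u0 ut].
have uu : u / 2 < u by lra.
have vr (v : R) : u / 2 <= v <= u -> `|v| < r.
  move=> /andP[v1 v2]; have v0 : 0 <= v by apply: le_trans v1; rewrite divr_ge0// ltW.
  by rewrite ger0_norm//; apply: le_lt_trans v2 _; exact: lt_trans ut tr.
have f1E' (v : R) : u / 2 <= v <= u -> is_derive v 1 f1 (f2 v).
  by move=> /vr; exact: f1E.
have cf1 : {within `[u / 2, u], continuous f1}.
  by apply: (is_derive_within (df := f2)) => v; rewrite /= in_itv; exact: f1E'.
have f1E'' (v : R) : v \in `](u / 2), u[%R -> is_derive v 1 f1 (f2 v).
  by rewrite in_itv/= => /andP[v1 v2]; apply: f1E'; rewrite !ltW.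
have [v + f1u] := MVT uu f1E'' cf1; rewrite in_itv/= => /andP[v1 v2].
have f2v : f2 v < k by apply: he; rewrite ger0_norm; lra.
have g0 : g 0 = 0 by rewrite /g mul0r expr0n/=; field.
have gt0 : 0 <= g t by have := fmid t; rewrite t0 tr => /(_ isT); rewrite /g; lra.
have : g t < 0.
  rewrite -[g t](subr0 (g t)) -[X in _ - X]g0 gt pmulr_llt0 ?subr0//.
  have : (k - f2 v) * u > 0 by rewrite mulr_gt0// subr_gt0.
  by rewrite f1u; lra.
by rewrite ltNge gt0.
Qed.

(** * The linear structure of the action for the arithmetic mean *)

Lemma theta2_ge0 (R : realType) (r s : R) :
  0 <= r -> 0 <= s -> 0 <= theta2 r s.
Proof. by move=> r0 s0; rewrite /theta2 divr_ge0// addr_ge0. Qed.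

Section duality.
Context (R : realType) (X : finType).
Variables (Q : X -> X -> R) (pi : X -> R).

(** The nonlinearity of the Hamilton-Jacobi equation [psi' = - hj psi]; its
    integral against a density is half the action ([pairing_hj]). *)
Definition hj (psi : X -> R) (x : X) : R :=
  4^-1 * \sum_y (psi y - psi x) ^+ 2 * Q x y.

(** The right-hand side of the continuity equation, solved for the time
    derivative of the density. *)
Definition transport (psi rho : X -> R) (x : X) : R :=
  - \sum_y (psi y - psi x) * theta2 (rho x) (rho y) * Q x y.

Definition pairing (f rho : X -> R) : R := \sum_x f x * rho x * pi x.

Hypothesis Qge0 : forall x y, x != y -> 0 <= Q x y.
Hypothesis pige0 : forall x, 0 <= pi x.
Hypothesis reversible : forall x y, Q x y * pi x = Q y x * pi y.

Lemma sum_symmetrize (g : X -> X -> R) :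
  \sum_x \sum_y g x y = \sum_x \sum_y (g x y + g y x) / 2.
Proof.
under [RHS]eq_bigr do under eq_bigr do rewrite mulrDl.
under [RHS]eq_bigr do rewrite big_split/=.
rewrite big_split/= [X in _ + X]exchange_big/= -big_split/=.
apply: eq_bigr => x _; rewrite -big_split/=.
by apply: eq_bigr => y _; rewrite -splitr.
Qed.

(** Discrete integration by parts: reversibility makes the edge weights
    symmetric, so the sum may be symmetrized in the two end points. *)
Lemma pairing_transport (f psi rho : X -> R) :
  pairing f (transport psi rho) = 2^-1 * \sum_x \sum_y
    (f y - f x) * (psi y - psi x) * theta2 (rho x) (rho y) * (Q x y * pi x).
Proof.
rewrite /pairing /transport.
under eq_bigr do rewrite mulrN mulNr mulr_sumr mulr_suml -sumrN.
rewrite sum_symmetrize mulr_sumr; apply: eq_bigr => x _.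
rewrite mulr_sumr; apply: eq_bigr => y _.
rewrite -[_ * _ * pi x]mulrA -[_ * _ * pi y]mulrA /theta2.
move: (reversible x y) => E.
by ring: E.
Qed.

Lemma pairing_hj (psi rho : X -> R) :
  2 * pairing (hj psi) rho = action (@theta2 R) Q pi rho psi.
Proof.
rewrite /pairing /hj /action.
under eq_bigr do rewrite mulr_sumr !mulr_suml.
rewrite sum_symmetrize !mulr_sumr; apply: eq_bigr => x _.
rewrite !mulr_sumr; apply: eq_bigr => y _; rewrite /theta2.
move: (reversible x y) => E.
by field: E.
Qed.

Lemma edge_ge0 (psi rho : X -> R) x y : (forall x, 0 <= rho x) ->
  0 <= (psi y - psi x) ^+ 2 * theta2 (rho x) (rho y) * (Q x y * pi x).
Proof.
move=> r0; case: (eqVneq x y) => [->|xy]; first by rewrite subrr expr0n !mul0r.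
apply: mulr_ge0; last by apply: mulr_ge0; [exact: Qge0|exact: pige0].
by apply: mulr_ge0; [exact: sqr_ge0|exact: theta2_ge0].
Qed.

Lemma action_ge0 (rho psi : X -> R) : (forall x, 0 <= rho x) ->
  0 <= action (@theta2 R) Q pi rho psi.
Proof.
move=> r0; rewrite /action mulr_ge0 ?invr_ge0// sumr_ge0// => x _.
rewrite sumr_ge0// => y _; rewrite -mulrA.
exact: edge_ge0.
Qed.

(** Young's inequality edge by edge: the difference of the two sides is half of
    the weighted sum of the squares of the increments of [psi - phi].  When
    [psi] solves the Hamilton-Jacobi equation and [rho] is driven by [phi], the
    left-hand side is the time derivative of [2 <psi, rho>]. *)
Lemma hj_dual_le (psi phi rho : X -> R) : (forall x, 0 <= rho x) ->
  2 * (pairing psi (transport phi rho) - pairing (hj psi) rho)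
    <= action (@theta2 R) Q pi rho phi.
Proof.
move=> r0; rewrite mulrBr pairing_hj pairing_transport /action.
rewrite mulrA divff// mul1r lerBlDr -mulrDr -big_split/=.
rewrite -subr_ge0 mulr_sumr -sumrB sumr_ge0// => x _.
rewrite -big_split mulr_sumr -sumrB/= sumr_ge0// => y _.
rewrite [leRHS](_ : _ = 2^-1 * ((psi y - psi x - (phi y - phi x)) ^+ 2
   * theta2 (rho x) (rho y) * (Q x y * pi x))); last by field.
rewrite mulr_ge0 ?invr_ge0//.
rewrite (_ : psi y - psi x - _ = psi y - phi y - (psi x - phi x)); last by ring.
exact: (edge_ge0 (fun z => psi z - phi z)).
Qed.

Lemma hj_dual_eq (psi rho : X -> R) :
  2 * (pairing psi (transport psi rho) - pairing (hj psi) rho)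
    = action (@theta2 R) Q pi rho psi.
Proof.
rewrite mulrBr pairing_hj pairing_transport /action.
rewrite mulrA divff// mul1r.
rewrite [X in X - _](_ : _ = \sum_x \sum_y (psi y - psi x) ^+ 2
  * theta2 (rho x) (rho y) * Q x y * pi x); first by field.
by apply: eq_bigr => x _; apply: eq_bigr => y _; rewrite expr2 !mulrA.
Qed.

Lemma transport_mass (psi rho : X -> R) :
  \sum_x transport psi rho x * pi x = 0.
Proof.
have := pairing_transport (fun=> 1) psi rho; rewrite /pairing.
under eq_bigr do rewrite mul1r.
move=> ->; rewrite big1 ?mulr0// => x _; rewrite big1// => y _.
by rewrite subrr !mul0r.
Qed.

(** The differential of [hj] at [psi] in the direction [dpsi]. *)
Definition dhj (psi dpsi : X -> R) (x : X) : R :=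
  2^-1 * \sum_y (psi y - psi x) * (dpsi y - dpsi x) * Q x y.

(** The two terms are the contributions of [psi] and of [rho] to the time
    derivative of [<hj psi, rho>], half the action, along the geodesic
    equations; it is the conservation of energy of the Hamiltonian system. *)
Lemma energy_balance (psi rho : X -> R) :
  pairing (dhj psi (fun x => - hj psi x)) rho
   + pairing (hj psi) (transport psi rho) = 0.
Proof.
rewrite pairing_transport /pairing /dhj.
under eq_bigr do rewrite mulr_sumr !mulr_suml.
rewrite sum_symmetrize mulr_sumr -big_split/= big1// => x _.
rewrite mulr_sumr -big_split/= big1// => y _; rewrite /theta2.
move: (reversible x y) => E.
by field: E.
Qed.

End duality.

(** * Hamilton-Jacobi flows *)

Section dynamics.
Context (R : realType) (X : finType).
Variables (Q : X -> X -> R) (pi : X -> R).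
Hypothesis reversible : forall x y, Q x y * pi x = Q y x * pi y.

Local Notation act := (action (@theta2 R) Q pi).

Definition hj_solution (A : set R) (psi : R -> X -> R) : Prop :=
  forall t x, A t -> is_derive t 1 (psi^~ x) (- hj Q (psi t) x).

(** The geodesic equations: Hamilton-Jacobi for the potential, continuity for
    the density. *)
Definition geodesic_flow (A : set R) (psi rho : R -> X -> R) : Prop :=
  hj_solution A psi /\
  forall t x, A t -> is_derive t 1 (rho^~ x) (transport Q (psi t) (rho t) x).

Lemma is_derive_pairing (f g : R -> X -> R) (df dg : X -> R) (t : R) :
  (forall x, is_derive t 1 (f^~ x) (df x)) ->
  (forall x, is_derive t 1 (g^~ x) (dg x)) ->
  is_derive t 1 (fun u => pairing pi (f u) (g u))
    (pairing pi df (g t) + pairing pi (f t) dg).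
Proof.
move=> fE gE; rewrite /pairing -big_split/=; apply: is_derive_bigsum => x.
have fx := fE x; have gx := gE x.
apply: is_derive_eq; rewrite /GRing.scale/=; ring.
Qed.

Lemma is_derive_hj (psi : R -> X -> R) (dpsi : X -> R) (t : R) x :
  (forall x, is_derive t 1 (psi^~ x) (dpsi x)) ->
  is_derive t 1 (fun u => hj Q (psi u) x) (dhj Q (psi t) dpsi x).
Proof.
move=> psiE; rewrite /hj /dhj.
have px := psiE x.
have -> : 2^-1 * (\sum_y (psi t y - psi t x) * (dpsi y - dpsi x) * Q x y)
  = 4^-1 * \sum_y (2 * (psi t y - psi t x) * (dpsi y - dpsi x) * Q x y).
  rewrite !mulr_sumr; apply: eq_bigr => y _; by field.
have H : is_derive t 1 (fun u => \sum_y (psi u y - psi u x) ^+ 2 * Q x y)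
   (\sum_y (2 * (psi t y - psi t x) * (dpsi y - dpsi x) * Q x y)).
  apply: is_derive_bigsum => y; have py := psiE y.
  apply: is_derive_eq; rewrite /GRing.scale/=; ring.
exact: is_deriveZ.
Qed.

Lemma action_cst (psi rho : R -> X -> R) (a b : R) : a <= b ->
  geodesic_flow [set t | a <= t <= b] psi rho ->
  act (rho b) (psi b) = act (rho a) (psi a).
Proof.
move=> ab [hpsi hrho].
rewrite -!(pairing_hj reversible); congr (_ * _).
apply: (@derive_eq0_cst _ (fun u => pairing pi (hj Q (psi u)) (rho u))) => // t tab.
have H1 x := @is_derive_hj psi _ t x (fun x => hpsi t x tab).
have H2 x := hrho t x tab.
have := is_derive_pairing H1 H2.
by rewrite energy_balance.
Qed.

End dynamics.

(** * The distance along a flow *)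

Section distance.
Context (R : realType) (X : finType).
Variables (Q : X -> X -> R) (pi : X -> R).
Hypothesis Qge0 : forall x y, x != y -> 0 <= Q x y.
Hypothesis pige0 : forall x, 0 <= pi x.
Hypothesis reversible : forall x y, Q x y * pi x = Q y x * pi y.

Local Notation act := (action (@theta2 R) Q pi).
Local Notation mu01 := (@lebesgue_measure R).

Lemma cvg_pairing T (F : set_system T) (FF : Filter F) (f g : T -> X -> R)
    (lf lg : X -> R) :
  (forall x, f^~ x @ F --> lf x) -> (forall x, g^~ x @ F --> lg x) ->
  (fun t => pairing pi (f t) (g t)) @ F --> pairing pi lf lg.
Proof.
move=> hf hg; apply: cvg_bigsum => x; apply: cvgMl; exact: cvgM.
Qed.

Lemma cvg_hj T (F : set_system T) (FF : Filter F) (f : T -> X -> R)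
    (lf : X -> R) x :
  (forall x, f^~ x @ F --> lf x) ->
  (fun t => hj Q (f t) x) @ F --> hj Q lf x.
Proof.
move=> hf; apply: cvgMr; apply: cvg_bigsum => y; apply: cvgMl.
by rewrite expr2; under eq_fun do rewrite expr2; apply: cvgM; apply: cvgB.
Qed.

Lemma measurable_action (D : set R) (rho psi : R -> X -> R) :
  (forall x, measurable_fun D (rho^~ x)) ->
  (forall x, measurable_fun D (psi^~ x)) ->
  measurable_fun D (fun t => act (rho t) (psi t)).
Proof.
move=> mr mp; apply: measurable_funM; first exact: measurable_cst.
apply: measurable_sum => x; apply: measurable_sum => y.
apply: measurable_funM; last exact: measurable_cst.
apply: measurable_funM; last exact: measurable_cst.
apply: measurable_funM.
  by apply: measurable_funX; apply: measurable_funB.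
by apply: measurable_funM; [exact: measurable_funD|exact: measurable_cst].
Qed.

(** The part of smoothness that is needed to integrate the time derivative of a
    competing curve over the whole of [[0, 1]]. *)
Lemma smooth01_derivative (f : R -> R) : smooth01 f ->
  exists df : R -> R, [/\ {within `[0, 1], continuous f},
    {within `[0, 1], continuous df} &
    forall t : R, 0 < t < 1 -> is_derive t 1 f (df t)].
Proof.
move=> [g <- gE]; exists (g 1%N); split.
- exact: derivable_oo_LRcontinuous_within (gE 0%N).1.
- exact: derivable_oo_LRcontinuous_within (gE 1%N).1.
- move=> t t01; have t01' : t \in `]0, 1[ by rewrite in_itv.
  have [[d _ _] e] := gE 0%N; rewrite -(e t t01') derive1E.
  by apply: DeriveDef => //; exact: d.
Qed.

(** Weak duality, by the fundamental theorem of calculus applied to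
    [2 <psi t, mu t>], whose derivative is at most the action. *)
Lemma action_integral_ge (psi : R -> X -> R) (mu phi : R -> X -> R)
    (rho0 rho1 : X -> R) :
  hj_solution Q [set t | 0 <= t <= 1] psi ->
  admissible (@theta2 R) Q pi rho0 rho1 mu phi ->
  ((2 * (pairing pi (psi 1) rho1 - pairing pi (psi 0) rho0))%:E <=
    \int[mu01]_(t in `[0%R, 1%R]) (act (mu t) (phi t))%:E)%E.
Proof.
move=> hpsi [smu dens [<- <-] mphi ce].
have [dmu dmuE] := choice (fun x => smooth01_derivative (smu x)).
pose G t := 2 * pairing pi (psi t) (mu t).
pose dG t := 2 * (pairing pi (fun x => - hj Q (psi t) x) (mu t)
                  + pairing pi (psi t) (fun x => dmu x t)).
have cpsi x : {within `[0, 1], continuous (psi^~ x)}.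
  apply: (@is_derive_within _ _ (fun t => - hj Q (psi t) x)) => t /=.
  by rewrite in_itv/= => t01; exact: hpsi.
have cdG : {within `[0, 1], continuous dG}.
  move=> t; apply: cvgMr; apply: cvgD; apply: cvg_pairing => x.
  - by apply: cvgN; apply: cvg_hj => y; exact: cpsi.
  - by have [c _ _] := dmuE x; exact: c.
  - exact: cpsi.
  - by have [_ c _] := dmuE x; exact: c.
have cG : {within `[0, 1], continuous G}.
  move=> t; apply: cvgMr; apply: cvg_pairing => x; first exact: cpsi.
  by have [c _ _] := dmuE x; exact: c.
have GE (t : R) : 0 < t < 1 -> is_derive t 1 G (dG t).
  move=> t01; apply: is_deriveZ; apply: is_derive_pairing => x.
  - by apply: hpsi; case/andP: t01 => t0 t1 /=; rewrite !ltW.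
  - by have [_ _] := dmuE x; exact.
have dG_le (t : R) : 0 < t < 1 -> dG t <= act (mu t) (phi t).
  move=> t01; apply: le_trans (hj_dual_le Qge0 pige0 reversible (psi t) (phi t) _).
  - rewrite ler_pM2l// addrC lerD//.
    + rewrite le_eqVlt; apply/orP; left; apply/eqP.
      congr (pairing _ _ _); apply/funext => x; have := ce x t t01.
      rewrite derive1E; have [_ _ /(_ t t01) [_ ->]] := dmuE x.
      by move/eqP; rewrite addr_eq0 => /eqP.
    + rewrite /pairing -sumrN; apply: ler_sum => x _.
      by rewrite !mulNr.
  - by apply: (dens t _).1; case/andP: t01 => t0 t1; rewrite !ltW.
have -> : ((2 * (pairing pi (psi 1) (mu 1) - pairing pi (psi 0) (mu 0)))%:E
  = \int[mu01]_(t in `[0%R, 1%R]) (dG t)%:E)%E.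
  rewrite (continuous_FTC2 ltr01 cdG (F := G)) ?mulrBr//.
  - move/(continuous_within_itvP _ ltr01) : cG => [_ c0 c1]; split => //.
    by move=> t; rewrite in_itv/= => /GE [].
  - by move=> t; rewrite in_itv/= derive1E => /GE [_ ->].
have mdG : measurable_fun (`[0, 1] : set R) dG.
  exact: subspace_continuous_measurable_fun.
have mact : measurable_fun (`[0, 1] : set R) (fun t => act (mu t) (phi t)).
  apply: measurable_action => // x; have [c _ _] := dmuE x.
  exact: subspace_continuous_measurable_fun.
have sub01 : (`]0, 1[ : set R) `<=` `[0, 1].
  by apply: subset_itv_oo_cc.
have mact' : measurable_fun (`]0, 1[ : set R) (fun t => (act (mu t) (phi t))%:E).
  by apply/measurable_EFinP; exact: measurable_funS mact.
have mdG' : measurable_fun (`]0, 1[ : set R) (fun t => (dG t)%:E).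
  by apply/measurable_EFinP; exact: measurable_funS mdG.
rewrite [leLHS]integral_itv_bndoo// [leRHS]integral_itv_bndoo//.
have act0 t : `]0, 1[%classic t -> (0 <= (act (mu t) (phi t))%:E)%E.
  rewrite /= in_itv/= => /andP[t0 t1]; rewrite lee_fin.
  by apply: action_ge0 => //; apply: (dens t _).1; rewrite !ltW.
(* The lower bound has no sign, so the comparison of integrals needs both sides
   to be integrable; a competitor of infinite action is set aside first. *)
have [->|fin] := eqVneq (\int[mu01]_(t in `]0%R, 1%R[) (act (mu t) (phi t))%:E)%E +oo%E.
  exact: leey.
apply: le_integral.
- exact: measurable_itv.
  apply: (@integrableS _ _ _ mu01 `[0, 1]%classic `]0, 1[%classic (EFin \o dG)) => //.
  apply: continuous_compact_integrable => //; exact: segment_compact.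
- apply/integrableP; split => //.
  rewrite [X in (X < _)%E](_ : _ =
    \int[mu01]_(t in `]0%R, 1%R[) (act (mu t) (phi t))%:E)%E ?ltey//.
  by apply: eq_integral => t; rewrite inE => t01; rewrite gee0_abs//; exact: act0.
- move=> t; rewrite inE/= in_itv/= => t01; rewrite lee_fin; exact: dG_le.
Qed.

(** A flow is its own dual certificate: the bound of [action_integral_ge] is
    attained by the flow itself, whose action is constant in time. *)
Lemma W_flow01 (psi rho : R -> X -> R) :
  geodesic_flow Q [set t | 0 <= t <= 1] psi rho ->
  (forall x, smooth_on [set t | 0 <= t <= 1] (rho^~ x)) ->
  (forall t : R, 0 <= t <= 1 -> is_density pi (rho t)) ->
  W (@theta2 R) Q pi (rho 0) (rho 1)
    = (Num.sqrt (act (rho 0) (psi 0)))%:E.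
Proof.
move=> flow srho dens; have [hpsi hrho] := flow.
have actE (t : R) : 0 <= t <= 1 -> act (rho t) (psi t) = act (rho 0) (psi 0).
  move=> /andP[t0 t1]; apply: (action_cst reversible t0).
  by split=> u x /= /andP[u0 ut]; [apply: hpsi|apply: hrho];
    rewrite /= u0 (le_trans ut).
have adm : admissible (@theta2 R) Q pi (rho 0) (rho 1) rho psi.
  split=> //.
  - by move=> x; apply: smooth_on_smooth01.
  - move=> x; apply: subspace_continuous_measurable_fun => //.
    apply: (@is_derive_within _ _ (fun t => - hj Q (psi t) x)) => t /=.
    by rewrite in_itv/= => t01; exact: hpsi.
  - move=> x t /andP[t0 t1]; rewrite derive1E.
    by have [|_ ->] := hrho t x _; rewrite /= ?(ltW t0) ?(ltW t1)// addNr.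
have intE : (\int[mu01]_(t in `[0%R, 1%R]) (act (rho t) (psi t))%:E =
    (act (rho 0) (psi 0))%:E)%E.
  rewrite [LHS](_ : _ =
    \int[mu01]_(t in `[0%R, 1%R]) (act (rho 0) (psi 0))%:E)%E.
    by rewrite integral_cst//= lebesgue_measure_itv/= lte_fin ltr01 oppr0 adde0 mule1.
  by apply: eq_integral => t; rewrite inE/= in_itv/= => t01; rewrite actE.
have pairE : 2 * (pairing pi (psi 1) (rho 1) - pairing pi (psi 0) (rho 0))
    = act (rho 0) (psi 0).
  pose D t := 2 * pairing pi (psi t) (rho t).
  have DE (t : R) : 0 <= t <= 1 -> is_derive t 1 D (act (rho 0) (psi 0)).
    move=> t01; rewrite -(actE t t01) -(hj_dual_eq reversible).
    apply: is_deriveZ.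
    have := is_derive_pairing pi (fun x => hpsi t x t01) (fun x => hrho t x t01).
    rewrite addrC; congr (is_derive _ _ _ (_ + _)).
    by rewrite /pairing -sumrN; apply: eq_bigr => x _; rewrite !mulNr.
  have cD : {within `[0, 1], continuous D}.
    by apply: (@is_derive_within _ _ (fun=> act (rho 0) (psi 0))) => t;
      rewrite /= in_itv; exact: DE.
  have DE' (t : R) : t \in `]0, 1[%R -> is_derive t 1 D (act (rho 0) (psi 0)).
    by rewrite in_itv/= => /andP[t0 t1]; apply: DE; rewrite !ltW.
  have [t _] := MVT_segment ler01 DE' cD.
  by rewrite /D subr0 mulr1 mulrBr.
rewrite /W.
suff -> : ereal_inf [set e : \bar R | exists rho' psi' : R -> X -> R,
    admissible (@theta2 R) Q pi (rho 0) (rho 1) rho' psi' /\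
    e = (\int[mu01]_(t in `[0%R, 1%R]) (act (rho' t) (psi' t))%:E)%E]
  = (act (rho 0) (psi 0))%:E by [].
apply/eqP; rewrite eq_le; apply/andP; split.
  by apply: ereal_inf_lbound; exists rho, psi; rewrite intE.
apply: le_ereal_inf_tmp => _ [mu [phi [admmu ->]]].
by rewrite -pairE; apply: action_integral_ge.
Qed.

End distance.

(** * Flows are geodesics of constant speed *)

Section geodesics.
Context (R : realType) (X : finType).
Variables (Q : X -> X -> R) (pi : X -> R).
Hypothesis Qge0 : forall x y, x != y -> 0 <= Q x y.
Hypothesis pige0 : forall x, 0 <= pi x.
Hypothesis reversible : forall x y, Q x y * pi x = Q y x * pi y.

Local Notation act := (action (@theta2 R) Q pi).

Lemma hjZ (d : R) (psi : X -> R) x :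
  hj Q (fun y => d * psi y) x = d ^+ 2 * hj Q psi x.
Proof.
rewrite /hj mulrCA [d ^+ 2 * _]mulr_sumr; congr (_ * _).
by apply: eq_bigr => y _; ring.
Qed.

Lemma transportZ (d : R) (psi rho : X -> R) x :
  transport Q (fun y => d * psi y) rho x = d * transport Q psi rho x.
Proof.
rewrite /transport mulrN mulr_sumr; congr (- _).
by apply: eq_bigr => y _; ring.
Qed.

Lemma actionZ (d : R) (psi rho : X -> R) :
  act rho (fun y => d * psi y) = d ^+ 2 * act rho psi.
Proof.
rewrite /action mulrCA; congr (_ * _); rewrite mulr_sumr.
apply: eq_bigr => x _; rewrite mulr_sumr.
by apply: eq_bigr => y _; ring.
Qed.

(** The factor [d] on the potential compensates the change of speed in both
    equations, since [hj] is quadratic and [transport] linear in it.  A negative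
    [d] reverses time and [d = 0] gives constant curves. *)
Lemma geodesic_flow_affine (A : set R) (psi rho : R -> X -> R) (a d : R) :
  geodesic_flow Q A psi rho ->
  geodesic_flow Q [set u | A (a + d * u)]
    (fun u x => d * psi (a + d * u) x) (fun u => rho (a + d * u)).
Proof.
move=> [hpsi hrho]; split=> u x Au.
- rewrite hjZ expr2 -mulrA -mulrN -mulrN.
  by apply: is_deriveZ; apply: (is_derive_affine (f := psi^~ x)); exact: hpsi.
- rewrite transportZ.
  by apply: (is_derive_affine (f := rho^~ x)); exact: hrho.
Qed.

Lemma geodesic_flowS (A B : set R) (psi rho : R -> X -> R) :
  B `<=` A -> geodesic_flow Q A psi rho -> geodesic_flow Q B psi rho.
Proof. by move=> BA [h1 h2]; split=> t x /BA; [exact: h1|exact: h2]. Qed.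

Section flow.
Variables (T : R) (psi rho : R -> X -> R).
Let I := [set t : R | 0 <= t <= T].
Hypothesis T0 : 0 <= T.
Hypothesis flow : geodesic_flow Q I psi rho.
Hypothesis srho : forall x, smooth_on I (rho^~ x).
Hypothesis dens : forall t, I t -> is_density pi (rho t).

(** The segment from [s] to [t], rescaled to unit time, is again a flow and has
    action [(t - s) ^ 2] times the conserved one. *)
Lemma W_flow s t : I s -> I t -> W (@theta2 R) Q pi (rho s) (rho t)
  = (`|s - t| * Num.sqrt (act (rho 0) (psi 0)))%:E.
Proof.
move=> Is It.
have sub : [set u : R | 0 <= u <= 1] `<=` [set u | I (s + (t - s) * u)].
  move=> u /andP[u0 u1]; move: Is It; rewrite /I/= => /andP[s0 sT] /andP[t0 tT].
  rewrite (_ : _ + _ = (1 - u) * s + u * t); last by ring.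
  have u1' : 0 <= 1 - u by rewrite subr_ge0.
  rewrite addr_ge0 ?mulr_ge0//=.
  rewrite (_ : T = (1 - u) * T + u * T); last by ring.
  by rewrite lerD// ler_wpM2l.
pose r u := rho (s + (t - s) * u).
have r0 : r 0 = rho s by rewrite /r mulr0 addr0.
have r1 : r 1 = rho t by rewrite /r mulr1 addrC subrK.
rewrite -r0 -r1 (@W_flow01 _ _ _ _ Qge0 pige0 reversible
  (fun u x => (t - s) * psi (s + (t - s) * u) x) r).
- congr EFin; rewrite r0 mulr0 addr0 actionZ sqrtrM ?sqr_ge0// sqrtr_sqr distrC.
  congr (_ * Num.sqrt _).
  have /andP[s0 sT] := Is; apply: (action_cst reversible s0).
  apply: geodesic_flowS flow => u /andP[u0 us].
  by rewrite /I/= u0 (le_trans us).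
- exact/(geodesic_flowS sub)/geodesic_flow_affine.
- move=> x; apply: (smooth_onS sub).
  exact: (smooth_on_affine (f := rho^~ x)).
- by move=> u /sub; exact: dens.
Qed.

Lemma flow_const_speed_geodesic :
  const_speed_geodesic (@theta2 R) Q pi (fun u => rho (T * u)).
Proof.
have sub (u : R) : 0 <= u <= 1 -> I (T * u).
  by move=> /andP[u0 u1]; rewrite /I/= mulr_ge0//= ler_piMr.
split=> [u /sub|s t /sub Is /sub It]; first exact: dens.
rewrite W_flow// W_flow; [|by apply: sub; rewrite lexx ler01..].
rewrite -EFinM !mulr0 mulr1 sub0r normrN -mulrBr normrM mulrA.
by rewrite [`|T| * _]mulrC.
Qed.

End flow.
End geodesics.

(** * Power series *)

Section power_series.
Context (R : realType).
Implicit Types (a b c : nat -> R) (r s t : R).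

(** Boundedness of [c n * s ^ n] for all [s < r] says that the radius of
    convergence is at least [r]; in this form the condition is visibly stable
    under termwise differentiation and products. *)
Definition radius_ge r c : Prop :=
  forall s, 0 <= s < r -> exists C, forall n, `|c n| * s ^+ n <= C.

Definition cauchy_prod a b (n : nat) : R := \sum_(i < n.+1) a i * b (n - i)%N.

Definition psum c t : R := limn (pseries c t).

Lemma between t r : `|t| < r -> exists2 s, `|t| < s & 0 < s < r.
Proof. move=> tr; exists ((`|t| + r) / 2); have := normr_ge0 t; lra. Qed.

(** [n.+1] copies of [s ^ n] are dominated by the first [n.+1] terms of the
    geometric series. *)
Lemma mulS_geometric_le s n : 0 <= s < 1 -> n.+1%:R * s ^+ n <= (1 - s)^-1.
Proof.
move=> /andP[s0 s1]; rewrite -[leRHS]div1r ler_pdivlMr ?subr_gt0//.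
apply: (@le_trans _ _ ((\sum_(i < n.+1) s ^+ i) * (1 - s))).
  apply: ler_wpM2r; first by rewrite subr_ge0 ltW.
  rewrite mulr_natl.
  rewrite -[n.+1 in leLHS]card_ord -sumr_const; apply: ler_sum => i _.
  by rewrite ler_wiXn2l// ?ltW// -ltnS.
have -> : (\sum_(i < n.+1) s ^+ i) * (1 - s) = 1 - s ^+ n.+1.
  by rewrite -[RHS]opprB subrX1 -mulNr opprB mulrC.
by rewrite gerBl exprn_ge0.
Qed.

Lemma radius_ge_mulS r c : radius_ge r c ->
  radius_ge r (fun n => n.+1%:R * c n).
Proof.
move=> rc s /andP[s0 sr].
have [u su /andP[u0 ur]] : exists2 u, `|s| < u & 0 < u < r.
  by apply: between; rewrite ger0_norm.
rewrite ger0_norm// in su.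
have [|C hC] := rc u; first by rewrite ltW.
have q1 : 0 <= s / u < 1 by rewrite divr_ge0 ?(ltW u0)//= ltr_pdivrMr// mul1r.
exists ((1 - s / u)^-1 * C) => n.
have -> : `|n.+1%:R * c n| * s ^+ n
    = (n.+1%:R * (s / u) ^+ n) * (`|c n| * u ^+ n).
  rewrite normrM normr_nat expr_div_n; field.
  by rewrite expf_neq0// gt_eqF.
apply: ler_pM; [|by rewrite mulr_ge0// exprn_ge0 ?ltW| |exact: hC].
  by rewrite mulr_ge0// exprn_ge0//; case/andP: q1.
exact: mulS_geometric_le.
Qed.

Lemma radius_ge_shift r c : radius_ge r c -> radius_ge r (fun n => c n.+1).
Proof.
move=> rc s /andP[s0 sr].
have [u su /andP[u0 ur]] : exists2 u, `|s| < u & 0 < u < r.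
  by apply: between; rewrite ger0_norm.
rewrite ger0_norm// in su.
have [|C hC] := rc u; first by rewrite ltW.
exists (C / u) => n; rewrite ler_pdivlMr//.
apply: le_trans (hC n.+1); rewrite exprSr -!mulrA ler_wpM2l//.
by rewrite ler_pM2r// lerXn2r// ?nnegrE ?ltW// ltW.
Qed.

Lemma radius_ge_diffs r c : radius_ge r c -> radius_ge r (pseries_diffs c).
Proof.
move=> /radius_ge_shift/radius_ge_mulS; exact.
Qed.

Lemma radius_ge_cvg r c t : radius_ge r c -> `|t| < r -> cvgn (pseries c t).
Proof.
move=> rc tr; have [u tu /andP[u0 ur]] := between tr.
have [|C hC] := rc u; first by rewrite ltW.
apply: normed_cvg.
apply: (@series_le_cvg _ _ (geometric C (`|t| / u))) => [n|n|n|] /=.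
- exact: normr_ge0.
- rewrite mulr_ge0// ?exprn_ge0 ?divr_ge0 ?(ltW u0)//.
  by apply: le_trans (hC 0%N); rewrite mulr_ge0.
- rewrite normrM normrX expr_div_n mulrCA mulrC.
  apply: ler_wpM2l; first exact: exprn_ge0.
  by rewrite ler_pdivlMr ?exprn_gt0.
- apply: is_cvg_geometric_series.
  by rewrite normrM normr_id normfV (gtr0_norm u0) ltr_pdivrMr// mul1r.
Qed.

Lemma sum_triangle (F : nat -> nat -> R) n :
  \sum_(k < n) \sum_(i < k.+1) F i (k - i)%N
    = \sum_(i < n) \sum_(j < n - i) F i j.
Proof.
elim: n => [|n IH]; first by rewrite !big_ord0.
rewrite big_ord_recr/= IH [RHS]big_ord_recr/= subSnn big_ord_recr/= subnn addrA.
rewrite -big_split/= big_ord1; congr (_ + _); apply: eq_bigr => i _.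
by rewrite subSn ?big_ord_recr//= ltnW.
Qed.

Lemma radius_ge_cauchy_prod r a b : radius_ge r a -> radius_ge r b ->
  radius_ge r (cauchy_prod a b).
Proof.
move=> ra rb.
suff H : radius_ge r (fun n => \sum_(i < n.+1) `|a i * b (n - i)%N|).
  move=> s sr; have [C hC] := H s sr; exists C => n; apply: le_trans (hC n).
  rewrite ler_wpM2r ?exprn_ge0//; first by case/andP: sr.
  rewrite [leRHS]ger0_norm; last by rewrite sumr_ge0.
  exact: ler_norm_sum.
move=> s /andP[s0 sr].
have [u su /andP[u0 ur]] : exists2 u, `|s| < u & 0 < u < r.
  by apply: between; rewrite ger0_norm.
rewrite ger0_norm// in su.
have [|A hA] := ra u; first by rewrite ltW.
have [|B hB] := rb u; first by rewrite ltW.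
have q1 : 0 <= s / u < 1 by rewrite divr_ge0 ?(ltW u0)//= ltr_pdivrMr// mul1r.
exists ((1 - s / u)^-1 * (A * B)) => n.
rewrite ger0_norm ?sumr_ge0//.
have H : (\sum_(i < n.+1) `|a i * b (n - i)%N|) * u ^+ n <= n.+1%:R * (A * B).
  rewrite mulr_suml mulr_natl -[n.+1 in leRHS]card_ord -sumr_const.
  apply: ler_sum => i _; rewrite normrM.
  have -> : u ^+ n = u ^+ i * u ^+ (n - i) by rewrite -exprD subnKC// -ltnS.
  rewrite mulrACA; apply: ler_pM; [| |exact: hA|exact: hB];
    by rewrite mulr_ge0// exprn_ge0// ltW.
have -> : (\sum_(i < n.+1) `|a i * b (n - i)%N|) * s ^+ n =
    (\sum_(i < n.+1) `|a i * b (n - i)%N|) * u ^+ n * (s / u) ^+ n.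
  rewrite expr_div_n -mulrA; congr (_ * _).
  by rewrite mulrC divfK// expf_neq0// gt_eqF.
apply: (@le_trans _ _ ((n.+1%:R * (s / u) ^+ n) * (A * B))); last first.
  rewrite ler_wpM2r ?mulS_geometric_le// mulr_ge0//.
    by apply: le_trans (hA 0%N); rewrite mulr_ge0.
  by apply: le_trans (hB 0%N); rewrite mulr_ge0.
rewrite [leRHS]mulrAC; apply: ler_wpM2r H.
by rewrite exprn_ge0//; case/andP: q1.
Qed.

Lemma cauchy_product_remainder a b t n :
  pseries a t n * pseries b t n - pseries (cauchy_prod a b) t n
  = \sum_(i < n) \sum_(n - i <= j < n) (a i * t ^+ i) * (b j * t ^+ j).
Proof.
rewrite /pseries /series/= !big_mkord.
have -> : \sum_(i < n) cauchy_prod a b i * t ^+ i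
    = \sum_(i < n) \sum_(j < n - i) (a i * t ^+ i) * (b j * t ^+ j).
  rewrite -(sum_triangle (fun i j => (a i * t ^+ i) * (b j * t ^+ j))).
  apply: eq_bigr => k _; rewrite /cauchy_prod mulr_suml; apply: eq_bigr => i _.
  have -> : t ^+ k = t ^+ i * t ^+ (k - i) by rewrite -exprD subnKC// -ltnS.
  by rewrite mulrACA.
rewrite mulr_suml -sumrB; apply: eq_bigr => i _.
rewrite mulr_sumr -(big_mkord xpredT (fun j => a i * t ^+ i * (b j * t ^+ j))).
rewrite -(big_mkord xpredT (fun j => a i * t ^+ i * (b j * t ^+ j))).
by rewrite (@big_cat_nat _ _ _ (n - i)) ?leq_subr//= addrAC subrr add0r.
Qed.

(** The remainder consists of at most [n ^ 2] terms, each [O(s ^ n)] for some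
    [s < 1]. *)
Lemma cvg_pseries_cauchy_prod r a b t :
  radius_ge r a -> radius_ge r b -> `|t| < r ->
  (fun n => pseries a t n * pseries b t n - pseries (cauchy_prod a b) t n)
    @ \oo --> 0.
Proof.
move=> ra rb tr; have [u tu /andP[u0 ur]] := between tr.
have [|A hA] := ra u; first by rewrite ltW.
have [|B hB] := rb u; first by rewrite ltW.
pose s := `|t| / u.
have q1 : 0 <= s < 1 by rewrite divr_ge0 ?(ltW u0)//= ltr_pdivrMr// mul1r.
have A0 : 0 <= A by apply: le_trans (hA 0%N); rewrite mulr_ge0.
have B0 : 0 <= B by apply: le_trans (hB 0%N); rewrite mulr_ge0.
(* [w n * s ^ n] dominates the remainder, and it is the general term of a
   convergent series. *)
pose w n : R := n.+1%:R * (n.+1%:R * (A * B)).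
have rw : radius_ge 1 w.
  do 2 apply: radius_ge_mulS.
  move=> v /andP[v0 v1]; exists (A * B) => n.
  by rewrite ger0_norm ?mulr_ge0// ler_piMr ?mulr_ge0// exprn_ile1// ltW.
have ws : (fun n => w n * s ^+ n) @ \oo --> 0.
  apply: cvg_series_cvg_0; apply: (radius_ge_cvg rw).
  by rewrite ger0_norm; case/andP: q1.
have term (c : nat -> R) C : (forall n, `|c n| * u ^+ n <= C) ->
    forall n, `|c n * t ^+ n| <= C * s ^+ n.
  move=> hc n; rewrite normrM normrX /s expr_div_n mulrCA [leLHS]mulrC.
  apply: ler_wpM2l; first exact: exprn_ge0.
  by rewrite ler_pdivlMr ?exprn_gt0.
apply/norm_cvg0P; apply: (@squeeze_cvgr _ _ _ _ (cst 0) (fun n => w n * s ^+ n));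
  [|exact: cvg_cst|exact: ws].
apply: nearW => n; rewrite normr_ge0/= cauchy_product_remainder.
apply: le_trans (ler_norm_sum _ _ _) _.
apply: (@le_trans _ _ (\sum_(i < n) n%:R * (A * B * s ^+ n))).
  apply: ler_sum => i _; apply: le_trans (ler_norm_sum _ _ _) _.
  apply: (@le_trans _ _ (\sum_(n - i <= j < n) (A * B * s ^+ n))).
    rewrite big_nat_cond [leRHS]big_nat_cond.
    apply: ler_sum => j; rewrite andbT => /andP[nij jn].
    rewrite normrM; apply: (@le_trans _ _ ((A * s ^+ i) * (B * s ^+ j))).
      by apply: ler_pM => //; apply: term.
    rewrite mulrACA -exprD; apply: ler_wpM2l; first exact: mulr_ge0.
    case/andP: q1 => s0 s1; rewrite ler_wiXn2l// ?ltW//.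
    by rewrite -leq_subLR.
  rewrite sumr_const_nat mulr_natl; apply: ler_wpMn2l.
    by rewrite !mulr_ge0// exprn_ge0//; case/andP: q1.
  by rewrite leq_subLR leq_addl.
rewrite sumr_const card_ord -[leLHS]mulr_natl /w -!mulrA.
have h : 0 <= A * (B * s ^+ n).
  by rewrite !mulr_ge0// exprn_ge0//; case/andP: q1.
have hn : n%:R <= n.+1%:R :> R by rewrite ler_nat.
by apply: ler_pM => //; [exact: mulr_ge0|exact: ler_wpM2r].
Qed.

(** A calculus of power series expansions on the ball of radius [r], so that a
    differential equation with polynomial right-hand side can be checked on
    coefficients. *)
Definition expands r c (f : R -> R) : Prop :=
  radius_ge r c /\ forall t, `|t| < r -> pseries c t @ \oo --> f t.

Lemma expands_psum r c : radius_ge r c -> expands r c (psum c).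
Proof. by move=> rc; split => // t tr; exact: radius_ge_cvg rc tr. Qed.

Lemma psum0 c : psum c 0 = c 0%N.
Proof.
apply: cvg_lim => //; rewrite -(cvg_shiftn 1)/=.
rewrite (_ : (fun n => _) = cst (c 0%N)); first exact: cvg_cst.
apply/funext => n; rewrite addn1 /pseries /series/= big_nat_recl//= expr0 mulr1.
by rewrite big1 ?addr0// => i _; rewrite expr0n/= mulr0.
Qed.

Lemma expandsM r a b (f g : R -> R) : expands r a f -> expands r b g ->
  expands r (cauchy_prod a b) (fun t => f t * g t).
Proof.
move=> [ra af] [rb bg]; split; first exact: radius_ge_cauchy_prod.
move=> t tr.
have -> : pseries (cauchy_prod a b) t = (fun n => pseries a t n * pseries b t n
    - (pseries a t n * pseries b t n - pseries (cauchy_prod a b) t n)).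
  by apply/funext => n; rewrite subKr.
rewrite -[f t * g t]subr0; apply: cvgB; last exact: cvg_pseries_cauchy_prod ra rb tr.
exact: cvgM (af t tr) (bg t tr).
Qed.

Lemma expandsD r a b (f g : R -> R) : expands r a f -> expands r b g ->
  expands r (fun n => a n + b n) (fun t => f t + g t).
Proof.
move=> [ra af] [rb bg]; split.
  move=> s sr; have [A hA] := ra s sr; have [B hB] := rb s sr.
  exists (A + B) => n; apply: le_trans (lerD (hA n) (hB n)).
  by rewrite -mulrDl ler_wpM2r ?ler_normD// exprn_ge0//; case/andP: sr.
move=> t tr.
have -> : pseries (fun n => a n + b n) t = pseries a t \+ pseries b t.
  apply/funext => n; rewrite /pseries /series/= -big_split/=.
  by apply: eq_bigr => i _; rewrite mulrDl.
exact: cvgD (af t tr) (bg t tr).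
Qed.

Lemma expandsZ r k a (f : R -> R) : expands r a f ->
  expands r (fun n => k * a n) (fun t => k * f t).
Proof.
move=> [ra af]; split.
  move=> s sr; have [A hA] := ra s sr; exists (`|k| * A) => n.
  by rewrite normrM -mulrA ler_wpM2l.
move=> t tr.
have -> : pseries (fun n => k * a n) t = (fun n => k * pseries a t n).
  apply/funext => n; rewrite /pseries /series/= mulr_sumr.
  by apply: eq_bigr => i _; rewrite mulrA.
by apply: cvgMr; exact: af.
Qed.

Lemma expandsN r a (f : R -> R) : expands r a f ->
  expands r (fun n => - a n) (fun t => - f t).
Proof.
move=> /(expandsZ (-1)).
by under eq_fun do rewrite mulN1r; under [X in expands _ _ X]eq_fun do rewrite mulN1r.
Qed.

Lemma expands0 r : expands r (fun=> 0) (fun=> 0).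
Proof.
split=> [s sr|t tr]; first by exists 0 => n; rewrite normr0 mul0r.
have -> : pseries (fun=> 0) t = cst 0.
  by apply/funext => n; rewrite /pseries /series/= big1// => i _; rewrite mul0r.
exact: cvg_cst.
Qed.

Lemma expands_sum r (I : Type) (l : seq I) (a : I -> nat -> R) (f : I -> R -> R) :
  (forall i, expands r (a i) (f i)) ->
  expands r (fun n => \sum_(i <- l) a i n) (fun t => \sum_(i <- l) f i t).
Proof.
move=> af; elim: l => [|i l IH].
  under eq_fun do rewrite big_nil.
  by under [X in expands _ _ X]eq_fun do rewrite big_nil; exact: expands0.
under eq_fun do rewrite big_cons.
by under [X in expands _ _ X]eq_fun do rewrite big_cons; exact: expandsD.
Qed.

Lemma psum_is_derive r c (g : R -> R) t : radius_ge r c ->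
  expands r (pseries_diffs c) g -> `|t| < r -> is_derive t 1 (psum c) (g t).
Proof.
move=> rc [rg cg] tr; have [u tu /andP[u0 ur]] := between tr.
have ur' : `|u| < r by rewrite gtr0_norm.
rewrite -(cvg_lim (@norm_hausdorff _ _) (cg t tr)).
apply: (@pseries_snd_diffs _ _ u).
- exact: radius_ge_cvg rc ur'.
- exact: radius_ge_cvg (radius_ge_diffs rc) ur'.
- exact: radius_ge_cvg (radius_ge_diffs (radius_ge_diffs rc)) ur'.
- by rewrite [`|u|]gtr0_norm.
Qed.

Lemma psum_smooth r c : radius_ge r c ->
  smooth_on [set t | `|t| < r] (psum c).
Proof.
move=> rc; exists (fun n => psum (iter n (@pseries_diffs R) c)) => //.
have rn n : radius_ge r (iter n (@pseries_diffs R) c).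
  by elim: n => //= n IH; exact: radius_ge_diffs.
move=> n t tr; apply: (psum_is_derive (rn n)) tr.
exact: (expands_psum (rn n.+1)).
Qed.

End power_series.

(** * Short-time existence of flows *)

(** The recursion is run on tables: [tbl n] is a whole sequence that is correct
    up to index [n], from which the entry of index [n.+1] can be computed. *)
Lemma course_of_values_rec (S : Type) (s0 : S) (step : (nat -> S) -> nat -> S) :
  (forall c c' n, (forall i, (i <= n)%N -> c i = c' i) -> step c n = step c' n) ->
  exists2 c : nat -> S, c 0%N = s0 & forall n, c n.+1 = step c n.
Proof.
move=> stepE.
pose tbl := fix tbl n : nat -> S := if n is n'.+1
  then fun k => if (k <= n')%N then tbl n' k else step (tbl n') n' else fun=> s0.
have tblE n k : (k <= n)%N -> tbl n k = tbl k k.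
  elim: n => [|n IH]; first by rewrite leqn0 => /eqP ->.
  by rewrite leq_eqVlt => /predU1P[-> //|]; rewrite ltnS => kn /=; rewrite kn IH.
exists (fun n => tbl n n) => // n; rewrite /= ltnn.
by apply: stepE => i; exact: tblE.
Qed.

Section existence.
Context (R : realType).

Lemma cauchy_prod_le (a b : nat -> R) (A B L : R) n :
  (forall i, (i <= n)%N -> `|a i| <= A * L ^+ i) ->
  (forall i, (i <= n)%N -> `|b i| <= B * L ^+ i) ->
  `|cauchy_prod a b n| <= n.+1%:R * (A * B * L ^+ n).
Proof.
move=> ha hb; apply: le_trans (ler_norm_sum _ _ _) _.
rewrite mulr_natl -[n.+1 in leRHS]card_ord -sumr_const.
apply: ler_sum => i _; rewrite normrM.
have -> : L ^+ n = L ^+ i * L ^+ (n - i) by rewrite -exprD subnKC// -ltnS.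
rewrite mulrACA; apply: ler_pM => //; [apply: ha|apply: hb]; last exact: leq_subr.
by rewrite -ltnS.
Qed.

Lemma cauchy_prod_eq (a b a' b' : nat -> R) n :
  (forall i, (i <= n)%N -> a i = a' i) -> (forall i, (i <= n)%N -> b i = b' i) ->
  cauchy_prod a b n = cauchy_prod a' b' n.
Proof.
move=> ha hb; apply: eq_bigr => i _; rewrite ha ?hb ?leq_subr//.
by rewrite -ltnS.
Qed.

Variables (X : finType) (Q : X -> X -> R).

(** The [n]-th Taylor coefficient of [hj psi], where [p] is the sequence of
    coefficients of [psi]. *)
Definition hj_coef (p : nat -> X -> R) (n : nat) (x : X) : R :=
  4^-1 * \sum_y cauchy_prod (fun i => p i y - p i x) (fun i => p i y - p i x) n
    * Q x y.

Definition transport_coef (p r : nat -> X -> R) (n : nat) (x : X) : R :=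
  - \sum_y cauchy_prod (fun i => p i y - p i x)
      (fun i => theta2 (r i x) (r i y)) n * Q x y.

Lemma flow_coefficients (psi0 rho0 : X -> R) :
  exists p r : nat -> X -> R, [/\ p 0%N = psi0, r 0%N = rho0,
    forall n x, n.+1%:R * p n.+1 x = - hj_coef p n x &
    forall n x, n.+1%:R * r n.+1 x = transport_coef p r n x].
Proof.
pose step (c : nat -> (X -> R) * (X -> R)) n : (X -> R) * (X -> R) :=
  (fun x => n.+1%:R^-1 * - hj_coef (fun i => (c i).1) n x,
   fun x => n.+1%:R^-1 *
     transport_coef (fun i => (c i).1) (fun i => (c i).2) n x).
have [|c c0 cS] := @course_of_values_rec _ (psi0, rho0) step.
  move=> c c' n cc'; congr pair; apply/funext => x; congr (_ * _);
    rewrite /hj_coef /transport_coef; congr (- _); last first.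
    apply: eq_bigr => y _; congr (_ * _).
    by apply: cauchy_prod_eq => i /cc' ->.
  congr (_ * _); apply: eq_bigr => y _; congr (_ * _).
  by apply: cauchy_prod_eq => i /cc' ->.
exists (fun n => (c n).1), (fun n => (c n).2).
by split=> [||n x|n x]; rewrite ?c0 ?cS//= mulVKf// pnatr_eq0.
Qed.

Section bounds.
Variables (K M P : R) (p r : nat -> X -> R).
Hypothesis Q_le : forall x, \sum_y `|Q x y| <= K.
Hypothesis p0_le : forall x, `|p 0%N x| <= M.
Hypothesis r0_le : forall x, `|r 0%N x| <= P.
Hypothesis pE : forall n x, n.+1%:R * p n.+1 x = - hj_coef p n x.
Hypothesis rE : forall n x, n.+1%:R * r n.+1 x = transport_coef p r n x.
Hypothesis K0 : 0 <= K.
Hypothesis M0 : 0 <= M.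
Hypothesis P0 : 0 <= P.

Let L := 2 * K * M.

Lemma sum_edge_le (f : X -> R) (B : R) x : (forall y, `|f y| <= B) -> 0 <= B ->
  `|\sum_y f y * Q x y| <= B * K.
Proof.
move=> fB B0; apply: le_trans (ler_norm_sum _ _ _) _.
apply: (@le_trans _ _ (B * \sum_y `|Q x y|)); last exact: ler_wpM2l.
by rewrite mulr_sumr; apply: ler_sum => y _; rewrite normrM ler_wpM2r.
Qed.

(** The factor [n.+1] of the number of terms of the Cauchy product cancels the
    factor [n.+1] of termwise differentiation; this is why a quadratic system
    has geometrically bounded coefficients. *)
Lemma p_le n x : `|p n x| <= M * L ^+ n.
Proof.
have L0 : 0 <= L by rewrite !mulr_ge0.
elim/ltn_ind: n x => -[|n] IH x; first by rewrite expr0 mulr1.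
have dp y i : (i <= n)%N -> `|p i y - p i x| <= 2 * M * L ^+ i.
  move=> ni; apply: le_trans (ler_normB _ _) _.
  by rewrite -mulrA mulr_natl mulr2n lerD// IH.
rewrite -(@ler_pM2l _ n.+1%:R)// -[n.+1%:R in leLHS]ger0_norm// -normrM pE normrN.
rewrite /hj_coef normrM ger0_norm ?invr_ge0//.
apply: (@le_trans _ _ (4^-1 * (n.+1%:R * (2 * M * (2 * M) * L ^+ n) * K))).
  rewrite ler_wpM2l ?invr_ge0//; apply: sum_edge_le => [y|].
    by apply: cauchy_prod_le; exact: dp.
  by rewrite !mulr_ge0// exprn_ge0.
rewrite exprS /L; have := exprn_ge0 n L0; rewrite /L => Ln0.
have : 0 <= n.+1%:R * K * M * M * (2 * K * M) ^+ n by rewrite !mulr_ge0.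
move: (n.+1%:R) (_ ^+ n) => u v; lra.
Qed.

(** The continuity equation is linear in the density, hence the same rate as for
    the potential, whatever the size [P] of the initial density. *)
Lemma r_le n x : `|r n x| <= P * L ^+ n.
Proof.
have L0 : 0 <= L by rewrite !mulr_ge0.
elim/ltn_ind: n x => -[|n] IH x; first by rewrite expr0 mulr1.
have dp y i : (i <= n)%N -> `|p i y - p i x| <= 2 * M * L ^+ i.
  move=> ni; apply: le_trans (ler_normB _ _) _.
  by rewrite -mulrA mulr_natl mulr2n lerD// p_le.
have th y i : (i <= n)%N -> `|theta2 (r i x) (r i y)| <= P * L ^+ i.
  move=> ni; rewrite /theta2 normrM [`|2^-1|]ger0_norm ?invr_ge0//.
  rewrite ler_pdivrMr//; apply: le_trans (ler_normD _ _) _.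
  by rewrite mulr_natr mulr2n lerD// IH.
rewrite -(@ler_pM2l _ n.+1%:R)// -[n.+1%:R in leLHS]ger0_norm// -normrM rE.
rewrite /transport_coef normrN.
apply: (@le_trans _ _ (n.+1%:R * (2 * M * P * L ^+ n) * K)).
  apply: sum_edge_le => [y|]; last by rewrite !mulr_ge0// exprn_ge0.
  by apply: cauchy_prod_le; [exact: dp|exact: th].
by rewrite exprS /L le_eqVlt; apply/orP; left; apply/eqP; ring.
Qed.

Lemma coef_radius (c : nat -> R) (C l : R) : 0 <= C -> 0 < l -> L <= l ->
  (forall n, `|c n| <= C * L ^+ n) -> radius_ge l^-1 c.
Proof.
move=> C0 l0 Ll cC s /andP[s0 sl]; exists C => n.
have L0 : 0 <= L by rewrite !mulr_ge0.
apply: (@le_trans _ _ (C * L ^+ n * s ^+ n)).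
  by rewrite ler_wpM2r// exprn_ge0.
rewrite -mulrA -exprMn ler_piMr// exprn_ile1 ?mulr_ge0//.
apply: (@le_trans _ _ (l * l^-1)); last by rewrite divff// gt_eqF.
by apply: ler_pM => //; exact: ltW.
Qed.

End bounds.

Theorem geodesic_flow_exists (psi0 rho0 : X -> R) :
  exists2 T : R, 0 < T & exists psi rho : R -> X -> R,
    [/\ psi 0 = psi0, rho 0 = rho0,
        geodesic_flow Q [set t | `|t| < T] psi rho &
        forall x, smooth_on [set t | `|t| < T] (rho^~ x)].
Proof.
have [p [r [p0 r0 pE rE]]] := flow_coefficients psi0 rho0.
pose K := \sum_x \sum_y `|Q x y|.
pose M := \sum_x `|psi0 x|.
pose P := \sum_x `|rho0 x|.
have le_sum (f : X -> R) x : (forall x, 0 <= f x) -> f x <= \sum_y f y.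
  by move=> f0; rewrite (bigD1 x)//= lerDl sumr_ge0.
have Q_le x : \sum_y `|Q x y| <= K.
  by apply: (le_sum (fun x => \sum_y `|Q x y|)) => z; exact: sumr_ge0.
have p0_le x : `|p 0%N x| <= M by rewrite p0; exact: (le_sum (fun x => `|psi0 x|)).
have r0_le x : `|r 0%N x| <= P by rewrite r0; exact: (le_sum (fun x => `|rho0 x|)).
have K0 : 0 <= K by apply: sumr_ge0 => x _; exact: sumr_ge0.
have M0 : 0 <= M by exact: sumr_ge0.
have P0 : 0 <= P by exact: sumr_ge0.
(* The added 1 keeps the radius [l^-1] meaningful when [2 * K * M = 0]. *)
pose l := 2 * K * M + 1.
have l0 : 0 < l by rewrite ltr_wpDl// !mulr_ge0.
have Ll : 2 * K * M <= l by rewrite lerDl.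
have rp x : radius_ge l^-1 (p^~ x).
  by apply: (coef_radius K0 M0 M0 l0 Ll) => n; exact: p_le.
have rr x : radius_ge l^-1 (r^~ x).
  by apply: (coef_radius K0 M0 P0 l0 Ll) => n; exact: r_le.
exists l^-1; first by rewrite invr_gt0.
pose psi t x := psum (p^~ x) t; pose rho t x := psum (r^~ x) t.
have psiE x : expands l^-1 (p^~ x) (psi^~ x) by exact: expands_psum.
have rhoE x : expands l^-1 (r^~ x) (rho^~ x) by exact: expands_psum.
have dpsiE x y : expands l^-1 (fun n => p n y - p n x) (fun t => psi t y - psi t x).
  by apply: expandsD => //; exact: expandsN.
exists psi, rho; split.
- by apply/funext => x; rewrite /psi psum0 p0.
- by apply/funext => x; rewrite /rho psum0 r0.
- split=> t x tl.
  + apply: (psum_is_derive (g := fun t => - hj Q (psi t) x) (rp x)) tl.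
    rewrite (_ : pseries_diffs _ = fun n => - hj_coef p n x); last first.
      by apply/funext => n; rewrite /pseries_diffs pE.
    apply: expandsN; apply: expandsZ; apply: expands_sum => y.
    under eq_fun do rewrite mulrC.
    under [X in expands _ _ X]eq_fun do rewrite mulrC expr2.
    by apply: expandsZ; exact: expandsM.
  + apply: (psum_is_derive (g := fun t => transport Q (psi t) (rho t) x) (rr x)) tl.
    rewrite (_ : pseries_diffs _ = transport_coef p r ^~ x); last first.
      by apply/funext => n; rewrite /pseries_diffs rE.
    apply: expandsN; apply: expands_sum => y.
    under eq_fun do rewrite mulrC; under [X in expands _ _ X]eq_fun do rewrite mulrC.
    apply: expandsZ; apply: expandsM => //; rewrite /theta2.
    under eq_fun do rewrite mulrC; under [X in expands _ _ X]eq_fun do rewrite mulrC.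
    by apply: expandsZ; exact: expandsD.
- by move=> x; exact: psum_smooth.
Qed.

End existence.

(** * Second variation of the Renyi entropy *)

Section second_variation.
Context (R : realType) (X : finType).
Variables (Q : X -> X -> R) (pi : X -> R).
Hypothesis Qge0 : forall x y, x != y -> 0 <= Q x y.
Hypothesis pige0 : forall x, 0 <= pi x.
Hypothesis reversible : forall x y, Q x y * pi x = Q y x * pi y.

Local Notation act := (action (@theta2 R) Q pi).

(** The second derivative of [renyi2] along the geodesic through [rho] with
    potential [psi], obtained by differentiating [sum_x rho x ^ 2 pi x] twice
    and replacing the time derivatives by the geodesic equations. *)
Definition renyi2_hessian (psi rho : X -> R) : R :=
  let drho := transport Q psi rho in
  2 * (pairing pi drho drho + pairing pi rho (fun x =>
    transport Q (fun y => - hj Q psi y) rho x + transport Q psi drho x)).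

Lemma cvg_transport T (F : set_system T) (FF : Filter F) (f g : T -> X -> R)
    (lf lg : X -> R) x :
  (forall x, f^~ x @ F --> lf x) -> (forall x, g^~ x @ F --> lg x) ->
  (fun t => transport Q (f t) (g t) x) @ F --> transport Q lf lg x.
Proof.
move=> hf hg; apply: cvgN; apply: cvg_bigsum => y; apply: cvgMl.
by apply: cvgM; [exact: cvgB|apply: cvgMl; exact: cvgD].
Qed.

Lemma cvg_renyi2_hessian T (F : set_system T) (FF : Filter F)
    (f g : T -> X -> R) (lf lg : X -> R) :
  (forall x, f^~ x @ F --> lf x) -> (forall x, g^~ x @ F --> lg x) ->
  (fun t => renyi2_hessian (f t) (g t)) @ F --> renyi2_hessian lf lg.
Proof.
move=> hf hg; apply: cvgMr; apply: cvgD.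
  by apply: cvg_pairing => x; exact: cvg_transport.
apply: cvg_pairing => // x; apply: cvgD; apply: cvg_transport => // y.
  by apply: cvgN; exact: cvg_hj.
exact: cvg_transport.
Qed.

Lemma is_derive_transport (psi rho : R -> X -> R) (dpsi drho : X -> R) (t : R) x :
  (forall x, is_derive t 1 (psi^~ x) (dpsi x)) ->
  (forall x, is_derive t 1 (rho^~ x) (drho x)) ->
  is_derive t 1 (fun u => transport Q (psi u) (rho u) x)
    (transport Q dpsi (rho t) x + transport Q (psi t) drho x).
Proof.
move=> psiE rhoE; rewrite /transport -opprD -big_split/=.
have px := psiE x; have rx := rhoE x.
apply: is_deriveN; apply: is_derive_bigsum => y.
have py := psiE y; have ry := rhoE y; rewrite /theta2.
by apply: is_derive_eq; rewrite /GRing.scale/=; ring.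
Qed.

Lemma renyi2_pairing (rho : X -> R) : renyi2 pi rho = pairing pi rho rho.
Proof. by apply: eq_bigr => x _; rewrite expr2. Qed.

Lemma geodesic_flow_mass (psi rho : R -> X -> R) (T t : R) :
  geodesic_flow Q [set t | `|t| < T] psi rho -> 0 <= t < T ->
  \sum_x rho t x * pi x = \sum_x rho 0 x * pi x.
Proof.
move=> [_ rhoE] /andP[t0 tT].
apply: (@derive_eq0_cst _ (fun u => \sum_x rho u x * pi x)) => // u /andP[u0 ut].
rewrite -[X in is_derive _ _ _ X](transport_mass reversible (psi u) (rho u)).
apply: is_derive_bigsum => x.
have h : is_derive u 1 (rho^~ x) (transport Q (psi u) (rho u) x).
  by apply: rhoE; rewrite /= ger0_norm// (le_lt_trans ut).
by apply: is_derive_eq; rewrite /GRing.scale/=; ring.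
Qed.

(** The positive initial density keeps the flow inside the densities for a short
    time, so that its initial segments are geodesics; the convexity inequality
    at their midpoints has as its second order term the asserted inequality. *)
Theorem geod_convex_hessian_ge (kappa : R) (psi0 rho0 : X -> R) :
  geod_convex (@theta2 R) Q pi (renyi2 pi) kappa ->
  (forall x, 0 < rho0 x) -> \sum_x rho0 x * pi x = 1 ->
  kappa * act rho0 psi0 <= renyi2_hessian psi0 rho0.
Proof.
move=> conv rho0_gt0 rho0_mass.
have [T T0 [psi [rho [psi00 rho00 flow srho]]]] := geodesic_flow_exists Q psi0 rho0.
have [psiE rhoE] := flow.
have T00 : `|0 : R| < T by rewrite normr0.
have pos : \forall t \near (0 : R), forall x, 0 < rho t x.
  have := @filter_forall R X (fun x t => 0 < rho t x) (nbhs (0 : R)) _; apply=> x.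
  have cx : {for 0, continuous (rho^~ x)} by exact: is_derive_continuous (rhoE _ _ _).
  by apply: cvgr_gt cx _ _; rewrite rho00.
have /nbhs_ballP[e /= e0 he] := pos.
(* Up to time [r] the flow exists and its density stays positive. *)
pose r := Num.min T e.
have r0 : 0 < r by rewrite lt_min T0.
have [rT re] : r <= T /\ r <= e by rewrite !ge_min !lexx orbT.
have dens t : 0 <= t < r -> is_density pi (rho t).
  move=> /andP[t0 tr]; split; last first.
    rewrite (geodesic_flow_mass flow); first by rewrite rho00.
    by rewrite t0 (lt_le_trans tr).
  move=> x; apply/ltW/he; rewrite /ball/= sub0r normrN ger0_norm//.
  exact: lt_le_trans re.
rewrite -rho00 -psi00.
pose dF t := 2 * pairing pi (rho t) (transport Q (psi t) (rho t)).
apply: (@midpoint_convex_second_derivative R (fun t => renyi2 pi (rho t)) dF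
  (fun t => renyi2_hessian (psi t) (rho t)) _ r r0).
- move=> t tr; have tT := lt_le_trans tr rT.
  under eq_fun do rewrite renyi2_pairing.
  have h x := rhoE t x tT.
  rewrite (_ : dF t = pairing pi (transport Q (psi t) (rho t)) (rho t)
    + pairing pi (rho t) (transport Q (psi t) (rho t))).
    exact: is_derive_pairing.
  rewrite /dF /pairing -big_split mulr_sumr/=.
  by apply: eq_bigr => x _; ring.
- move=> t tr; have tT := lt_le_trans tr rT.
  have hr x := rhoE t x tT; have hp x := psiE t x tT.
  have ht x := is_derive_transport x hp hr.
  apply: is_deriveZ; exact: is_derive_pairing.
- by apply: cvg_renyi2_hessian => x; apply: is_derive_continuous;
    [exact: psiE|exact: rhoE].
- move=> t /andP[t0 tr].
  have sub : [set u : R | 0 <= u <= t] `<=` [set u | `|u| < T].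
    move=> u /andP[u0 ut]; rewrite /= ger0_norm//.
    by apply: le_lt_trans ut _; exact: lt_le_trans tr rT.
  have flow_t := geodesic_flowS sub flow.
  have srho_t x := smooth_onS sub (srho x).
  have dens_t u : 0 <= u <= t -> is_density pi (rho u).
    by move=> /andP[u0 ut]; apply: dens; rewrite u0 (le_lt_trans ut).
  have geo := flow_const_speed_geodesic Qge0 pige0 reversible (ltW t0)
    flow_t srho_t dens_t.
  have half01 : 0 <= (2^-1 : R) <= 1 by rewrite invr_ge0 invf_le1// ler0n ler1n.
  have := conv _ geo _ half01.
  rewrite (W_flow Qge0 pige0 reversible flow_t srho_t dens_t);
    [|by rewrite /= ?mulr0 ?mulr1 lexx ltW..].
  rewrite mulr0 mulr1 sub0r normrN -EFin_expe -EFinM -EFinB lee_fin.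
  rewrite exprMn sqr_sqrtr; last first.
    by apply: action_ge0 => // x; rewrite rho00 ltW.
  rewrite real_normK ?num_real// => /le_trans; apply.
  by rewrite le_eqVlt; apply/orP; left; apply/eqP; field.
Qed.

End second_variation.

(** * The cycle *)

Section cycle.
Context (R : realType) (N : nat) (q : R).
Hypothesis hN : (5 <= N)%N.
Hypothesis hq : 0 < q.

Local Notation Z := 'Z_N.
Local Notation Q := (@discrete_laplacian R N q).
Local Notation pi := (uniform_pi R N).
Local Notation act := (action (@theta2 R) Q pi).

Let N1 : (1 < N)%N. Proof. exact: leq_trans hN. Qed.
Let NR : N%:R != 0 :> R. Proof. by rewrite pnatr_eq0 -lt0n ltnW. Qed.

Lemma natZ_neq (x y : Z) k : x - y = k%:R -> (0 < k < N)%N -> (x == y) = false.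
Proof.
move=> xy /andP[k0 kN]; apply/negbTE; rewrite -subr_eq0 xy.
by rewrite -val_eqE/= val_Zp_nat// modn_small// -lt0n.
Qed.

Lemma one_neq0 : (1 == 0 :> Z) = false.
Proof. by apply: (@natZ_neq _ _ 1); [ring|exact: leq_trans hN]. Qed.
Lemma oneN_neq0 : (- 1 == 0 :> Z) = false.
Proof. by rewrite eq_sym; apply: (@natZ_neq _ _ 1); [ring|exact: leq_trans hN]. Qed.
Lemma one_neqN1 : (1 == - 1 :> Z) = false.
Proof. by apply: (@natZ_neq _ _ 2); [ring|exact: leq_trans hN]. Qed.
Lemma two_neq0 : (1 + 1 == 0 :> Z) = false.
Proof. by apply: (@natZ_neq _ _ 2); [ring|exact: leq_trans hN]. Qed.
Lemma two_neq1 : (1 + 1 == 1 :> Z) = false.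
Proof. by apply: (@natZ_neq _ _ 1); [ring|exact: leq_trans hN]. Qed.
Lemma two_neqN1 : (1 + 1 == - 1 :> Z) = false.
Proof. by apply: (@natZ_neq _ _ 3); [ring|exact: leq_trans hN]. Qed.
Lemma two_neqN2 : (1 + 1 == - 1 - 1 :> Z) = false.
Proof. by apply: (@natZ_neq _ _ 4); [ring|exact: leq_trans hN]. Qed.
Lemma twoN_neq0 : (- 1 - 1 == 0 :> Z) = false.
Proof. by rewrite eq_sym; apply: (@natZ_neq _ _ 2); [ring|exact: leq_trans hN]. Qed.
Lemma twoN_neq1 : (- 1 - 1 == 1 :> Z) = false.
Proof. by rewrite eq_sym; apply: (@natZ_neq _ _ 3); [ring|exact: leq_trans hN]. Qed.
Lemma twoN_neqN1 : (- 1 - 1 == - 1 :> Z) = false.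
Proof. by rewrite eq_sym; apply: (@natZ_neq _ _ 1); [ring|exact: leq_trans hN]. Qed.

Lemma discrete_laplacian_ge0 (x y : Z) : x != y -> 0 <= Q x y.
Proof.
rewrite /discrete_laplacian => /negbTE ->.
by case: ifP => // _; exact: ltW.
Qed.

Lemma discrete_laplacian_sym (x y : Z) : Q x y = Q y x.
Proof.
rewrite /discrete_laplacian -[y - x]opprB eqr_oppLR eqr_opp orbC.
by rewrite [y == x]eq_sym.
Qed.

Lemma uniform_reversible (x y : Z) : Q x y * pi x = Q y x * pi y.
Proof. by rewrite discrete_laplacian_sym. Qed.

Lemma sum_indicator (g : Z -> R) a : \sum_y g y * (y == a)%:R = g a.
Proof.
rewrite (bigD1 a)//= eqxx mulr1 big1 ?addr0// => y /negbTE ->.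
by rewrite mulr0.
Qed.

Lemma sum_discrete_laplacian (g : Z -> R) x : g x = 0 ->
  \sum_y g y * Q x y = q * (g (x + 1) + g (x - 1)).
Proof.
move=> gx; rewrite -(sum_indicator g (x + 1)) -(sum_indicator g (x - 1)).
rewrite -big_split/= mulr_sumr; apply: eq_bigr => y _.
rewrite /discrete_laplacian.
have -> : (x - y == 1) = (y == x - 1).
  by rewrite subr_eq [RHS]eq_sym subr_eq addrC.
have -> : (x - y == - 1) = (y == x + 1).
  by rewrite subr_eq addrC eq_sym subr_eq.
have [->|ym] := eqVneq y (x - 1).
  have -> : (x - 1 == x + 1) = false by rewrite (inj_eq (addrI x)) eq_sym one_neqN1.
  by rewrite mulr0 mulr1 add0r mulrC.
have [->|yp] := eqVneq y (x + 1); first by rewrite mulr0 mulr1 addr0 mulrC.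
have [<-|xy] := eqVneq x y; first by rewrite gx !mul0r addr0 mulr0.
by rewrite !mulr0 addr0 mulr0.
Qed.

(** A potential whose increment is 1 across the two edges at 0 and 0 across the
    next two: the equal slopes keep the mass at 0 stationary to first order,
    and the flat edges next to them make the slope grow where mass leaves 0 and
    decay where it enters, which drains 0 to second order. *)
Definition slope (x : Z) : R :=
  (x == 1)%:R + (x == 1 + 1)%:R - (x == - 1)%:R - (x == - 1 - 1)%:R.

(** The mixture of the point mass at 0, of density [N], with weight [1 - e] and
    of the uniform density with weight [e]. *)
Definition spike (e : R) (x : Z) : R := e + (1 - e) * N%:R * (x == 0)%:R.

Let neqs := (one_neq0, oneN_neq0, one_neqN1, two_neq0, two_neq1, two_neqN1,
  two_neqN2, twoN_neq0, twoN_neq1, twoN_neqN1).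

Lemma slope0 : slope 0 = 0.
Proof. by rewrite /slope ![0 == _]eq_sym !neqs /=; ring. Qed.
Lemma slope1 : slope 1 = 1.
Proof.
rewrite /slope eqxx [1 == 1 + 1 :> Z]eq_sym [1 == - 1 - 1 :> Z]eq_sym !neqs /=.
by ring.
Qed.
Lemma slope2 : slope (1 + 1) = 1.
Proof. by rewrite /slope eqxx !neqs /=; ring. Qed.
Lemma slopeN1 : slope (- 1) = - 1.
Proof. by rewrite /slope eqxx ![- 1 == _ :> Z]eq_sym !neqs /=; ring. Qed.
Lemma slopeN2 : slope (- 1 - 1) = - 1.
Proof. by rewrite /slope eqxx [- 1 - 1 == 1 + 1 :> Z]eq_sym !neqs /=; ring. Qed.

Let slopes := (slope0, slope1, slope2, slopeN1, slopeN2).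

Lemma hj_cycle (psi : Z -> R) x : hj Q psi x =
  q / 4 * ((psi (x + 1) - psi x) ^+ 2 + (psi (x - 1) - psi x) ^+ 2).
Proof.
rewrite /hj (@sum_discrete_laplacian (fun y => (psi y - psi x) ^+ 2)).
  by rewrite mulrA [4^-1 * q]mulrC.
by rewrite subrr expr0n.
Qed.

Lemma transport_cycle (psi rho : Z -> R) x : transport Q psi rho x =
  - q * ((psi (x + 1) - psi x) * theta2 (rho x) (rho (x + 1))
       + (psi (x - 1) - psi x) * theta2 (rho x) (rho (x - 1))).
Proof.
rewrite /transport
  (@sum_discrete_laplacian (fun y => (psi y - psi x) * theta2 (rho x) (rho y))).
  by rewrite mulNr.
by rewrite subrr mul0r.
Qed.

Lemma spike_mass e : \sum_x spike e x * pi x = 1.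
Proof.
have se : \sum_(x : Z) e = N%:R * e.
  by rewrite sumr_const card_ord Zp_cast// mulr_natl.
rewrite -mulr_suml /spike big_split/= se.
by rewrite (sum_indicator (fun=> (1 - e) * N%:R)) /uniform_pi; field.
Qed.

Lemma spike_transport x : transport Q slope (spike 0) x =
  q * N%:R / 2 * ((x == 1)%:R - (x == - 1)%:R).
Proof.
rewrite transport_cycle /theta2 /spike !add0r subr0 mul1r.
have [->|x1] := eqVneq x 1.
  by rewrite subrr !eqxx !slopes !neqs /=; field.
have [->|xN1] := eqVneq x (- 1).
  by rewrite addNr !eqxx !slopes !neqs /=; field.
have -> : (x + 1 == 0) = false by rewrite addr_eq0 (negbTE xN1).
have -> : (x - 1 == 0) = false by rewrite subr_eq0 (negbTE x1).
have [->|x0] := eqVneq x 0; last by rewrite /=; field.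
by rewrite add0r sub0r !slopes /=; field.
Qed.

Lemma pairing_spike (f : Z -> R) : pairing pi f (spike 0) = f 0.
Proof.
rewrite /pairing -[RHS](sum_indicator f 0); apply: eq_bigr => x _.
by rewrite /spike /uniform_pi add0r subr0 mul1r; field.
Qed.

Lemma pairingC (f g : Z -> R) : pairing pi f g = pairing pi g f.
Proof. by apply: eq_bigr => x _; rewrite [f x * _]mulrC. Qed.

Lemma action_spike : act (spike 0) slope = q.
Proof.
rewrite -(pairing_hj uniform_reversible) pairing_spike hj_cycle add0r sub0r.
by rewrite !slopes; field.
Qed.

(** Up to the common factor 2, the contributions are the square of the velocity
    [spike_transport], the change of the potential and the change of the density
    along the flow.  The first,
    [q ^ 2 N / 2], is outweighed by the other two, whose sum is
    [- 3 q ^ 2 N / 4]. *)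
Lemma renyi2_hessian_spike :
  renyi2_hessian Q pi slope (spike 0) = - (q ^+ 2 * N%:R / 2).
Proof.
rewrite /renyi2_hessian [X in _ + X]pairingC pairing_spike.
have -> : pairing pi (transport Q slope (spike 0)) (transport Q slope (spike 0))
    = q ^+ 2 * N%:R / 2.
  rewrite /pairing; under eq_bigr do rewrite spike_transport.
  have E (x : Z) : q * N%:R / 2 * ((x == 1)%:R - (x == -1)%:R) *
      (q * N%:R / 2 * ((x == 1)%:R - (x == -1)%:R)) * pi x
    = (q ^+ 2 * N%:R / 4) * (x == 1)%:R + (q ^+ 2 * N%:R / 4) * (x == -1)%:R.
    rewrite /uniform_pi; have [->|x1] := eqVneq x 1.
      by rewrite one_neqN1 /=; field.
    by case: eqVneq => _ /=; field.
  under eq_bigr do rewrite E.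
  by rewrite big_split/= !(sum_indicator (fun=> _)); field.
have -> : transport Q (fun y => - hj Q slope y) (spike 0) 0 = - (q ^+ 2 * N%:R / 4).
  rewrite transport_cycle !hj_cycle /theta2 /spike add0r sub0r eqxx !neqs.
  by rewrite subrr addNr !slopes /=; field.
have -> : transport Q slope (transport Q slope (spike 0)) 0 = - (q ^+ 2 * N%:R / 2).
  rewrite transport_cycle /theta2 !spike_transport (add0r (1 : Z)) (sub0r (1 : Z)).
  rewrite !slopes ![0 == _ :> Z]eq_sym !eqxx [- 1 == 1 :> Z]eq_sym !neqs /=.
  by field.
by field.
Qed.

Lemma spike_continuous x : {for 0, continuous (spike^~ x)}.
Proof.
apply: (@is_derive_continuous _ _ _ (1 - N%:R * (x == 0)%:R)); rewrite /spike.
by apply: is_derive_eq; rewrite /GRing.scale/=; ring.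
Qed.

(** The inequality of [geod_convex_hessian_ge] holds for [spike e] with
    [0 < e < 1]; both sides are continuous in [e], so it persists at [e = 0]. *)
Lemma renyi2_cycle_convexity_le (kappa : R) :
  geod_convex (@theta2 R) Q pi (renyi2 pi) kappa -> kappa <= - (q * N%:R / 2).
Proof.
move=> conv.
have pi0 x : 0 <= pi x by rewrite invr_ge0.
have sc x : spike e x @[e --> 0^'+] --> spike 0 x.
  exact/cvg_at_right_filter/spike_continuous.
have : kappa * (2 * pairing pi (hj Q slope) (spike 0))
    <= renyi2_hessian Q pi slope (spike 0).
  have cact : kappa * (2 * pairing pi (hj Q slope) (spike e)) @[e --> 0^'+]
      --> kappa * (2 * pairing pi (hj Q slope) (spike 0)).
    by apply: cvgMr; apply: cvgMr; apply: cvg_pairing => // x; exact: cvg_cst.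
  have chess : renyi2_hessian Q pi slope (spike e) @[e --> 0^'+]
      --> renyi2_hessian Q pi slope (spike 0).
    by apply: cvg_renyi2_hessian => // x; exact: cvg_cst.
  apply: (ler_cvg_to cact chess); near=> e.
  rewrite (pairing_hj uniform_reversible).
  apply: (geod_convex_hessian_ge discrete_laplacian_ge0 pi0 uniform_reversible) => //.
  + move=> x; rewrite /spike ltr_pwDl// mulr_ge0// mulr_ge0// subr_ge0.
    by near: e; exact: nbhs_right_le.
  + exact: spike_mass.
rewrite (pairing_hj uniform_reversible) action_spike renyi2_hessian_spike => h.
rewrite -(ler_pM2r hq) (le_trans h)//.
by rewrite le_eqVlt; apply/orP; left; apply/eqP; field.
Unshelve. all: by end_near.
Qed.

End cycle.

Theorem proposition4p5 (R : realType) (N : nat) (q : R)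
    (hN : (6 <= N)%N) (hq : 0 < q) :
  let Q := @discrete_laplacian R N q in
  let pi := uniform_pi R N in
  ~ geod_convex (@theta2 R) Q pi (renyi2 pi) 0 /\
  (kappaQ (@theta2 R) Q pi (renyi2 pi) <= (- (q * N%:R / 2))%:E)%E.
Proof.
move=> Q pi; have hN5 : (5 <= N)%N by exact: ltnW.
split.
- move=> /(renyi2_cycle_convexity_le hN5 hq); rewrite oppr_ge0 leNgt.
  by rewrite divr_gt0// mulr_gt0// ltr0n (leq_trans _ hN).
- apply: ge_ereal_sup => _ [k hk <-]; rewrite lee_fin.
  exact: renyi2_cycle_convexity_le.
Qed.
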